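(* Let $s=(s(i_D))_{D\in\mathcal{D},\,i_D\in\mathcal{I}_D^*}\in\mathbb{R}^{J}$ and $\alpha\in\mathbb{R}$. The prior $$\pi_G(\theta|s,\alpha)\ \propto\ \exp\Big\{\sum_{D\in\mathcal{D}}\sum_{i_D\in\mathcal{I}_D^*}\theta_D(i_D)s(i_D)-\alpha\log\Big(1+\sum_{i\in\mathcal{I},\,i\neq i^*}\exp\sum_{D\in\mathcal{D}_i^*}\theta_D(i_D)\Big)\Big\},\qquad \theta\in\mathbb{R}^{J},$$ is proper (that is, the integral over $\mathbb{R}^J$ with respect to Lebesgue measure of the right-hand side is finite) if and only if $(s,\alpha)\in\Pi_G$, where $\Pi_G$ is the set of all pairs $(s,\alpha)$ such that $\alpha>0$ and there exists $\theta\in\mathbb{R}^J$ with $$\frac{s(i_D)}{\alpha}=\sum_{j\in\mathcal{I},\,j_D=i_D}p_\theta(j)\qquad\text{for all } D\in\mathcal{D},\ i_D\in\mathcal{I}_D^*.$$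
   Context: $V$ is a finite set of criteria. For each $\gamma\in V$, $\mathcal{I}_\gamma$ is a finite set of levels containing a distinguished level $0$. The set of cells is $\mathcal{I}=\prod_{\gamma\in V}\mathcal{I}_\gamma$, and $i^*=(0,\dots,0)\in\mathcal{I}$. For $i\in\mathcal{I}$ and $E\subseteq V$, $i_E=(i_\gamma)_{\gamma\in E}$. For $\emptyset\ne E\subseteq V$, $\mathcal{I}_E^*=\{(i_\gamma)_{\gamma\in E}\in\prod_{\gamma\in E}\mathcal{I}_\gamma:\ i_\gamma\neq 0\ \forall\gamma\in E\}$. $\mathcal{D}$ is the set of interactions of a hierarchical log-linear model: a set of nonempty subsets of $V$ such that every nonempty subset of a member of $\mathcal{D}$ is in $\mathcal{D}$. (For the saturated model $\mathcal{D}$ is the set of all nonempty subsets of $V$; for the graphical model Markov with respect to an undirected graph $G$ with vertex set $V$, $\mathcal{D}$ is the set of nonempty complete subsets of $G$.) Put $J=\{(D,i_D): D\in\mathcal{D},\ i_D\in\mathcal{I}_D^*\}$; the log-linear parameter is $\theta=(\theta_D(i_D))_{D\in\mathcal{D},i_D\in\mathcal{I}_D^*}\in\mathbb{R}^J$. For $i\in\mathcal{I}$, $\mathcal{D}_i^*=\{D\in\mathcal{D}:\ i_\gamma\neq0\ \forall\gamma\in D\}$. The cell probabilities corresponding to $\theta$ are $$p_\theta(i)=\frac{\exp\sum_{D\in\mathcal{D}_i^*}\theta_D(i_D)}{1+\sum_{j\in\mathcal{I},\,j\ne i^*}\exp\sum_{D\in\mathcal{D}_j^*}\theta_D(j_D)},\qquad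 i\in\mathcal{I}$$ (an empty sum is $0$).
   Formalization: The formal theorem assumes that J is nonempty (the model has at least one parameter); if J is empty, the integral over the one-point space is finite for every α, including α ≤ 0, while Π_G requires α > 0, so the equivalence fails. *)

(* Defs.v *)
From HB Require Import structures.
From mathcomp Require Import all_boot all_order all_algebra.
From mathcomp Require Import all_classical all_reals all_analysis.

Set Implicit Arguments.
Unset Strict Implicit.
Unset Printing Implicit Defensive.

Import Order.TTheory GRing.Theory Num.Theory.
Import numFieldNormedType.Exports.

Local Open Scope classical_set_scope.
Local Open Scope ring_scope.

Lemma product_measure1_sigma_finite d1 d2 (T1 : measurableType d1)
    (T2 : measurableType d2) (R : realType)
    (m1 : {sigma_finite_measure set T1 -> \bar R})
    (m2 : {sigma_finite_measure set T2 -> \bar R}) :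
  sigma_finite setT (m1 \x m2)%E.
Proof.
have /sigma_finiteP[F [TF ndF Foo]] := sigma_finiteT m1.
have /sigma_finiteP[G [TG ndG Goo]] := sigma_finiteT m2.
exists (fun n => F n `*` G n).
  rewrite -setXTT TF TG; apply/seteqP; split => [[x y] /= [[n _ Fnx] [k _ Gky]]|].
    by exists (maxn n k) => //; split;
      [move: x Fnx; exact/subsetPset/ndF/leq_maxl
      |move: y Gky; exact/subsetPset/ndG/leq_maxr].
  by move=> [x y] [n _ [/= Fnx Gny]]; split; exists n.
move=> k; have [? ?] := Foo k; have [? ?] := Goo k.
split; first exact: measurableX.
by rewrite product_measure1E// lte_mul_pinfty// ge0_fin_numE.
Qed.

Section cons_measure.
Context {R : realType} (n : nat).
Local Notation rvec k := (k.-tuple (measurableTypeR R)).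
Variable m : {sigma_finite_measure set (rvec n) -> \bar R}.

Definition cons_pair (xt : measurableTypeR R * rvec n) : rvec n.+1 :=
  [tuple of xt.1 :: xt.2].

Lemma measurable_cons_pair : measurable_fun setT cons_pair.
Proof. exact: measurable_cons. Qed.

Definition cons_measure : set (rvec n.+1) -> \bar R :=
  pushforward (@lebesgue_measure R \x m)%E cons_pair.

Let cons_measure0 : cons_measure set0 = 0%E.
Proof. by rewrite /cons_measure /pushforward preimage_set0 measure0. Qed.

Let cons_measure_ge0 A : (0 <= cons_measure A)%E.
Proof. by rewrite /cons_measure /pushforward measure_ge0. Qed.

Let cons_measure_semi_sigma_additive : semi_sigma_additive cons_measure.
Proof.
move=> F mF tF mUF; rewrite /cons_measure /pushforward preimage_bigcup.
have mpre A : measurable A -> measurable (cons_pair @^-1` A).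
  by move=> mA; rewrite -[X in measurable X]setTI; exact: measurable_cons_pair.
apply: measure_semi_sigma_additive.
- by move=> k; exact: mpre.
- apply/trivIsetP => /= i j _ _ ij; rewrite -preimage_setI.
  by move/trivIsetP : tF => /(_ _ _ _ _ ij) ->//; rewrite preimage_set0.
- by rewrite -preimage_bigcup; exact: mpre.
Qed.

HB.instance Definition _ := isMeasure.Build _ _ _ cons_measure
  cons_measure0 cons_measure_ge0 cons_measure_semi_sigma_additive.

Let cons_measure_sigma_finite : sigma_finite setT cons_measure.
Proof.
have [F FT Foo] : sigma_finite setT (@lebesgue_measure R \x m)%E.
  exact: product_measure1_sigma_finite.
pose uncons (t : rvec n.+1) : measurableTypeR R * rvec n :=
  (thead t, [tuple of behead t]).
have munc : measurable_fun setT uncons.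
  apply/measurable_fun_pairP; split; first exact: measurable_tnth.
  exact: measurable_behead.
have unK : cancel cons_pair uncons.
  by move=> [x t]; congr pair; exact/val_inj.
exists (fun k => uncons @^-1` F k).
  by rewrite -preimage_bigcup -FT preimage_setT.
move=> k; have [mF Fk] := Foo k; split.
  by rewrite -[X in measurable X]setTI; exact: munc.
rewrite /cons_measure /pushforward -comp_preimage.
by rewrite (_ : uncons \o cons_pair = id) //; apply/funext => x; exact: unK.
Qed.

HB.instance Definition _ :=
  Measure_isSigmaFinite.Build _ _ _ cons_measure cons_measure_sigma_finite.

End cons_measure.

(* Lebesgue measure on R^n, as an iterated product measure; its values on boxes
   are given by [lebesgue_tuple_box]. *)
Fixpoint lebesgue_tuple {R : realType} (n : nat) :
    {sigma_finite_measure set (n.-tuple (measurableTypeR R)) -> \bar R} :=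
  match n with
  | 0 => \d_([tuple] : 0.-tuple (measurableTypeR R))
  | k.+1 => cons_measure (lebesgue_tuple k)
  end.

Lemma measurable_box (R : realType) (n : nat)
    (A : 'I_n -> set (measurableTypeR R)) :
  (forall i, measurable (A i)) ->
  measurable [set t : n.-tuple (measurableTypeR R) | forall i, A i (tnth t i)].
Proof.
move=> mA; rewrite (_ : mkset _ =
    \bigcap_(i in [set: 'I_n]) ((@tnth _ _)^~ i @^-1` A i)).
  apply: fin_bigcap_measurable; first exact: finite_finset.
  move=> i _; rewrite -[X in measurable X]setTI.
  exact: measurable_tnth.
by apply/seteqP; split => [t At i _|t At i]; exact: At.
Qed.

Lemma lebesgue_tuple_box (R : realType) (n : nat)
    (A : 'I_n -> set (measurableTypeR R)) :
  (forall i, measurable (A i)) ->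
  lebesgue_tuple n [set t | forall i, A i (tnth t i)] =
  (\prod_(i < n) lebesgue_measure (A i))%E.
Proof.
elim: n A => [|n IHn] A mA.
  by rewrite big_ord0 /= diracE mem_set //= => -[].
rewrite big_ord_recl -IHn //= /cons_measure /pushforward.
have mA' : measurable [set t : n.-tuple (measurableTypeR R) |
    forall i, A (lift ord0 i) (tnth t i)].
  exact: (@measurable_box _ _ (fun i => A (lift ord0 i))).
rewrite -product_measure1E //.
congr ((_ \x _)%E _); apply/seteqP; split => -[x t] /=.
  move=> At; split=> [|i]; first exact: (At ord0).
  by have := At (lift ord0 i); rewrite tnthS.
move=> [A0 At] i; case: (unliftP ord0 i) => [j|] -> //.
by rewrite tnthS; exact: At.
Qed.

Section loglinear.
Variables (V : finType) (I_ : V -> finType) (lvl0 : forall g, I_ g).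
Variable DD : {set {set V}}.

Definition hierarchical : Prop :=
  finset.set0 \notin DD /\
  forall D E : {set V},
    D \in DD -> E \subset D -> E != finset.set0 -> E \in DD.

Definition cell : finType := {dffun forall g : V, I_ g}.

Definition cell0 : cell := [ffun g => lvl0 g].

Definition margin (E : {set V}) : finType :=
  {dffun forall g : {g : V | g \in E}, I_ (val g)}.

Definition restr (E : {set V}) (i : cell) : margin E :=
  [ffun g : {g : V | g \in E} => i (val g)].

Definition margin_star (E : {set V}) : {set margin E} :=
  [set x : margin E | [forall g, x g != lvl0 (val g)]].

(* J, the set of pairs (D, x) with D in DD and x in I_D^* *)
Definition param_index : finType :=
  {x : {D : {set V} & margin D} |
    (tag x \in DD) && (tagged x \in margin_star (tag x))}.

Definition Dstar (i : cell) : {set {set V}} :=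
  [set D in DD | [forall g in D, i g != lvl0 g]].

Lemma restr_param_subproof (i : cell) (D : {D : {set V} | D \in Dstar i}) :
  let x := Tagged margin (restr (val D) i) in
  (tag x \in DD) && (tagged x \in margin_star (tag x)).
Proof.
have := valP D; rewrite inE => /andP[DDD /forall_inP Di].
by rewrite /= DDD inE; apply/forallP => g; rewrite ffunE; exact/Di/(valP g).
Qed.

Definition restr_param (i : cell) (D : {D : {set V} | D \in Dstar i}) : param_index :=
  Sub (Tagged margin (restr (val D) i)) (restr_param_subproof D).

Variable R : realType.
Implicit Types (theta s : {ffun param_index -> R}) (alpha : R).

Definition cell_logit theta (i : cell) : R :=
  \sum_(D : {D : {set V} | D \in Dstar i}) theta (restr_param D).

Definition normalizer theta : R :=
  1 + \sum_(j : cell | j != cell0) expR (cell_logit theta j).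

Definition cell_prob theta (i : cell) : R :=
  expR (cell_logit theta i) / normalizer theta.

Definition prior_kernel s alpha theta : R :=
  expR (\sum_(x : param_index) theta x * s x - alpha * ln (normalizer theta)).

(* R^J is identified with R^n, for n the cardinal of J, by [Finfun]. *)
Definition proper_prior s alpha : Prop :=
  (\int[lebesgue_tuple #|param_index|]_t (prior_kernel s alpha (Finfun t))%:E < +oo)%E.

Definition Pi_G : set ({ffun param_index -> R} * R) :=
  [set p : {ffun param_index -> R} * R | 0 < p.2 /\
    exists theta : {ffun param_index -> R}, forall x : param_index,
      p.1 x / p.2 =
      \sum_(j : cell | restr (tag (val x)) j == tagged (val x))
        cell_prob theta j].

End loglinear.

(* Main.v *)
Require Import Defs.
From mathcomp Require Import all_boot all_order all_algebra.
From mathcomp Require Import all_classical all_reals all_analysis.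
From mathcomp Require Import measurable_realfun lra.
Set Implicit Arguments.
Unset Strict Implicit.
Unset Printing Implicit Defensive.
Local Open Scope ring_scope.
Import Order.TTheory GRing.Theory Num.Theory.
Import numFieldNormedType.Exports.
Local Open Scope classical_set_scope.

(** The log-linear model is a finite exponential family: with the 0/1 vectors
    f i recording which margins of the cell i are indexed by J, the cell i has
    logit <theta, f i>, the normalizer is Z theta, the sum over i of
    exp <theta, f i>, and the prior kernel is exp (- h) for the function
    h theta = alpha * log Z theta - <theta, s>.  The equivalence holds for every
    family such that some f i0 is zero and no nonzero vector is orthogonal to
    all the f i ([proper_iff_mean]).  Everything goes through the condition

      for every u <> 0 there is i such that <u, s> < alpha * <u, f i>

    ([strictly_supported]); when alpha > 0, it says that s / alpha is interior
    to the convex hull of the f i.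

    - If the integral is finite, then alpha > 0 and the condition holds.
      Otherwise there is a nonzero direction u along which h does not grow; then
      exp (- h) is at least some e > 0 on all the translates of the unit box
      by the multiples m * u, m in nat.  After scaling u, these are infinitely
      many disjoint sets of measure 1 ([integral_eq_pinfty_unit_boxes],
      [proper_alpha_gt0], [proper_strictly_supported]).

    - Under the condition, compactness of the unit sphere makes h grow at least
      like c times the l1 norm, for some c > 0 ([strictly_supported_growth]).
      So exp (- h) is dominated by the product of the functions
      exp (- c * |theta x|), which has a finite integral by Tonelli
      ([growth_proper]), and h attains its minimum
      ([strictly_supported_argmin]).

    - At a minimizer of h the gradient vanishes, and this is exactly the
      equation that s is alpha times the mean of f under the corresponding
      cell probabilities ([argmin_potential_mean]).

    - Conversely, if s / alpha is such a mean, then it is a convex combination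
      of the f i with positive weights only, so a linear form that nowhere
      exceeds its value at s / alpha is constant on the f i; it vanishes at
      f i0 = 0, so it is zero ([mean_strictly_supported]).

    For the log-linear model, the absence of a nonzero vector orthogonal to all
    the f i is a triangularity property: for (D, m) in J, the only other
    elements of J seen by the cell that extends m by zero levels are indexed by
    proper subsets of D ([suff_stat_identifiable]). *)

(** * Integration over R^n *)

(** Tonelli, applied once per coordinate. *)
Lemma integral_lebesgue_tuple_prod (R : realType) (n : nat)
    (g : 'I_n -> measurableTypeR R -> R) :
  (forall i, measurable_fun setT (g i)) -> (forall i x, 0 <= g i x) ->
  (\int[lebesgue_tuple n]_t (\prod_(i < n) g i (tnth t i))%:E =
   \prod_(i < n) \int[lebesgue_measure]_x (g i x)%:E)%E.
Proof.
elim: n g => [|n IHn] g mg g0.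
  rewrite big_ord0; under eq_integral do rewrite big_ord0.
  by rewrite integral_cst //= mul1e diracT.
pose F (t : n.+1.-tuple (measurableTypeR R)) : R :=
  \prod_(i < n.+1) g i (tnth t i).
pose G (t : n.-tuple (measurableTypeR R)) : R :=
  \prod_(i < n) g (lift ord0 i) (tnth t i).
have mG : measurable_fun setT G.
  apply: measurable_prod => i _.
  apply: measurableT_comp; first exact: mg.
  exact: measurable_tnth.
have mF : measurable_fun setT F.
  apply: measurable_prod => i _.
  apply: measurableT_comp; first exact: mg.
  exact: measurable_tnth.
have G0 t : 0 <= G t by apply: prodr_ge0.
have F0 t : 0 <= F t by apply: prodr_ge0.
have FE xt : F (cons_pair xt) = g ord0 xt.1 * G xt.2.
  rewrite /F big_ord_recl tnth0; congr (_ * _).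
  by apply: eq_bigr => i _; rewrite tnthS.
have mFc : measurable_fun setT (EFin \o F \o cons_pair (R := R) (n := n)).
  apply: measurableT_comp; first exact/measurable_EFinP; exact: measurable_cons_pair.
transitivity (\int[pushforward (lebesgue_measure \x lebesgue_tuple n)
   (cons_pair (R := R) (n := n))]_t (F t)%:E)%E.
  by [].
rewrite (ge0_integral_pushforward (@measurable_cons_pair R n)) //; last 2 first.
- exact/measurable_EFinP.
- by move=> t _; rewrite lee_fin.
rewrite preimage_setT (fubini_tonelli1 _ mFc); last by move=> x; rewrite lee_fin.
rewrite big_ord_recl -IHn //.
have IG0 : (0 <= \int[lebesgue_tuple n]_t (G t)%:E)%E.
  by apply: integral_ge0 => t _; rewrite lee_fin.
rewrite -ge0_integralZr //; last 2 first.
- by apply/measurable_EFinP; exact: mg.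
- by move=> x _; rewrite lee_fin.
apply: eq_integral => x _; rewrite /fubini_F -ge0_integralZl ?lee_fin //; last 2 first.
- exact/measurable_EFinP.
- by move=> t _; rewrite lee_fin; exact: G0.
by apply: eq_integral => t _ /=; rewrite FE EFinM.
Qed.

(** On the half-line this is, up to the factor c, the exponential density. *)
Lemma integral_expR_opp_abs (R : realType) (c : R) : 0 < c ->
  (\int[lebesgue_measure]_x (expR (- (c * `|x|)))%:E < +oo)%E.
Proof.
move=> c0.
rewrite ge0_symfun_integralT; first last.
- by move=> x /=; rewrite normrN.
- move=> x.
  apply: (@continuous_comp _ _ _ (fun x : R => - (c * `|x|)) expR);
    last exact: continuous_expR.
  by apply: cvgN; apply: cvgM; [exact: cvg_cst|exact: norm_continuous].
- by move=> x; exact: expR_ge0.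
have mpdf : measurable_fun setT (EFin \o exponential_pdf c).
  by apply/measurable_EFinP; exact: measurable_exponential_pdf.
have m0 : measurable [set x : R | 0 <= x].
  by rewrite (_ : mkset _ = `[0, +oo[) // set_itvcy.
have pdf0 x : (0 <= (exponential_pdf c x)%:E)%E.
  by rewrite lee_fin; apply: exponential_pdf_ge0; exact: ltW.
have -> : (\int[lebesgue_measure]_(x in [set x : R | (0 <= x)%R])
    (expR (- (c * `|x|)))%:E = c^-1%:E *
  \int[lebesgue_measure]_(x in [set x : R | (0 <= x)%R]) (exponential_pdf c x)%:E)%E.
  rewrite -ge0_integralZl //; last 2 first.
  - exact: measurable_funTS.
  - by rewrite lee_fin invr_ge0 ltW.
  apply: eq_integral => x; rewrite inE /= => x0.
  by rewrite exponential_pdfE // -EFinM mulKf ?gt_eqF // ger0_norm // mulNr.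
rewrite muleA -EFinM.
apply: (@le_lt_trans _ _ ((2 * c^-1)%:E * 1)%E); last by rewrite mule1 ltry.
apply: lee_pmul => //.
- by rewrite lee_fin mulr_ge0 // invr_ge0 ltW.
- by apply: integral_ge0.
rewrite -(integral_exponential_pdf c0).
exact: ge0_subset_integral.
Qed.

(** The unit boxes with corners at the multiples of u are pairwise disjoint, as
    their projections on the coordinate i0 are intervals of length 1 whose
    origins are at least 1 apart.  Half-open boxes are needed for this. *)
Lemma integral_eq_pinfty_unit_boxes (R : realType) (n : nat) (u : 'I_n -> R)
    (i0 : 'I_n)
    (k : n.-tuple (measurableTypeR R) -> R) (e : R) :
  1 <= `|u i0| -> measurable_fun setT k -> (forall t, 0 <= k t) -> 0 < e ->
  (forall (m : nat) t,
    (forall i, m%:R * u i <= tnth t i < m%:R * u i + 1) -> e <= k t) ->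
  (\int[lebesgue_tuple n]_t (k t)%:E = +oo)%E.
Proof.
move=> u1 mk k0 e0 ek.
pose A (m : nat) (i : 'I_n) : set (measurableTypeR R) :=
  `[m%:R * u i, m%:R * u i + 1[.
pose B (m : nat) := [set t : n.-tuple (measurableTypeR R) | forall i, A m i (tnth t i)].
have mB m : measurable (B m).
  by apply: measurable_box => i; exact: measurable_itv.
have mU : measurable (\bigcup_m B m) by exact: bigcup_measurable.
have B1 m : lebesgue_tuple n (B m) = 1%E.
  rewrite lebesgue_tuple_box; last by move=> i; exact: measurable_itv.
  apply: big1 => i _; rewrite lebesgue_measure_itv /= lte_fin ltrDl ltr01.
  by rewrite -EFinD addrC addKr.
have tB : trivIset setT B.
  apply/trivIsetP => /= p q _ _ pq; rewrite -subset0 => t [/= /(_ i0) + /(_ i0)].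
  rewrite /A /= !in_itv /= => /andP[p1 p2] /andP[q1 q2].
  have : `|(p%:R - q%:R) * u i0| < 1.
    by rewrite mulrBl ltr_norml; apply/andP; split; lra.
  apply/negP; rewrite -leNgt normrM -[leLHS]mulr1 ler_pM //.
  rewrite !pmulrn -intrB -intr_norm ler1z.
  by rewrite -gtz0_ge1 normr_gt0 subr_eq0 eqz_nat.
have mkE : measurable_fun setT (EFin \o k) by exact/measurable_EFinP.
have : (\int[lebesgue_tuple n]_(t in \bigcup_m B m) e%:E <=
        \int[lebesgue_tuple n]_t (k t)%:E)%E.
  apply: (@le_trans _ _ (\int[lebesgue_tuple n]_(t in \bigcup_m B m) (k t)%:E)%E).
    apply: ge0_le_integral => //.
    - by move=> t _; rewrite lee_fin ltW.
    - exact: measurable_funTS.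
    move=> t [m _ Bmt]; rewrite lee_fin; apply: (ek m) => i.
    by have := Bmt i; rewrite /A /= in_itv.
  by apply: ge0_subset_integral => // t _; rewrite lee_fin.
rewrite integral_cst // measure_bigcup //.
rewrite (eq_eseriesr (fun m _ => B1 m)).
rewrite (_ : (\sum_(0 <= i <oo | i \in setT) 1 = +oo)%E).
  by rewrite gt0_muley ?lte_fin // leye_eq => /eqP.
apply/eqyP => r r0; pose N := Num.bound r.
apply: (@le_trans _ _ N%:R%:E).
  by rewrite lee_fin; apply/ltW/archi_boundP/ltW.
have := @nneseries_lim_ge R (fun=> 1%E) (fun i => i \in setT) 0 N (fun _ _ _ => lee01).
apply: le_trans; rewrite big_mkord (eq_bigl xpredT); last by move=> i; rewrite in_setT.
by rewrite sumr_const card_ord EFin_natmul.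
Qed.

(** * Finite exponential families *)

Lemma is_derive_sum_seq (R : realType) (K : Type) (r : seq K)
    (F : K -> R -> R) (dF : K -> R) (x : R) :
  (forall k, is_derive x 1 (F k) (dF k)) ->
  is_derive x 1 (fun t => \sum_(k <- r) F k t) (\sum_(k <- r) dF k).
Proof.
move=> dFk; elim: r => [|k r IHr].
  rewrite (_ : (fun _ => _) = cst 0); last by apply/funext => t; rewrite big_nil.
  by rewrite big_nil; exact: is_derive_cst.
rewrite (_ : (fun _ => _) = F k + (fun t => \sum_(k <- r) F k t)).
  by rewrite big_cons; exact: is_deriveD.
by apply/funext => t; rewrite big_cons.
Qed.

Lemma continuous_scale_sub (R : realType) (T : topologicalType) (a : R)
    (g h : T -> R) :
  continuous g -> continuous h -> continuous (fun t => a * g t - h t).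
Proof.
move=> cg ch t; apply: cvgB; last exact: ch.
by apply: cvgM; [exact: cvg_cst|exact: cg].
Qed.

Section ExponentialFamily.
Variables (R : realType) (I J : finType) (f : I -> J -> R).
Implicit Types (u v s : J -> R) (alpha : R).

Definition dot u v : R := \sum_x u x * v x.

Definition l1norm u : R := \sum_x `|u x|.

Definition partition_function u : R := \sum_i expR (dot u (f i)).

(** The probability of i, and the expectation of the coordinate x of f, under
    the member u of the family. *)
Definition prob u i : R := expR (dot u (f i)) / partition_function u.

Definition mean u x : R := \sum_i f i x * prob u i.

(** The function h whose exponential exp (- h) is the unnormalized
    conjugate prior density. *)
Definition potential s alpha u : R :=
  alpha * ln (partition_function u) - dot u s.

(** When alpha > 0: the point s / alpha is interior to the convex hull of the
    f i, phrased with support functions. *)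
Definition strictly_supported s alpha : Prop :=
  forall u, (exists x, u x != 0) -> exists i, dot u s < alpha * dot u (f i).

Lemma dot_line u v w t : dot (fun x => u x + t * v x) w = dot u w + t * dot v w.
Proof.
by rewrite /dot mulr_sumr -big_split; apply: eq_bigr => x _; rewrite mulrDl mulrA.
Qed.

Lemma dotZl t u w : dot (fun x => t * u x) w = t * dot u w.
Proof. by rewrite /dot mulr_sumr; apply: eq_bigr => x _; rewrite mulrA. Qed.

Lemma dot_delta x w : dot (fun y => (y == x)%:R) w = w x.
Proof.
rewrite /dot (bigD1 x) //= eqxx mul1r big1 ?addr0 // => y /negPf ->.
by rewrite mul0r.
Qed.

Lemma le_l1norm u x : `|u x| <= l1norm u.
Proof. by rewrite /l1norm (bigD1 x) //= lerDl sumr_ge0. Qed.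

Lemma ler_exp_partition u i : expR (dot u (f i)) <= partition_function u.
Proof.
by rewrite /partition_function (bigD1 i) //= lerDl sumr_ge0 // => *; exact: expR_ge0.
Qed.

Lemma partition_function_gt0 (i : I) u : 0 < partition_function u.
Proof. by apply: lt_le_trans (ler_exp_partition u i); exact: expR_gt0. Qed.

Lemma ler_dot_ln_partition u i : dot u (f i) <= ln (partition_function u).
Proof.
by rewrite -[leLHS]expRK ler_ln ?posrE ?expR_gt0 ?(partition_function_gt0 i)
  ?ler_exp_partition.
Qed.

(** ** Coercivity and minimizers of the potential *)

Lemma continuous_coord x : continuous (fun u : {ptws J -> R} => u x).
Proof. exact: (@proj_continuous J (fun=> R) x). Qed.

Lemma continuous_dot v : continuous (fun u : {ptws J -> R} => dot u v).
Proof.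
apply: (continuous_big (op := +%R)) => [|x _]; first exact: add_continuous.
by move=> u; exact: (cvgM (@continuous_coord x u) (cvg_cst (v x))).
Qed.

Lemma continuous_l1norm : continuous (fun u : {ptws J -> R} => l1norm u).
Proof.
apply: (continuous_big (op := +%R)) => [|x _]; first exact: add_continuous.
by move=> u; exact: (cvg_norm (@continuous_coord x u)).
Qed.

Lemma continuous_partition :
  continuous (fun u : {ptws J -> R} => partition_function u).
Proof.
apply: (continuous_big (op := +%R)) => [|i _]; first exact: add_continuous.
move=> u; exact: (cvg_comp _ _ (@continuous_dot (f i) u) (@continuous_expR R _)).
Qed.

Lemma continuous_potential (i0 : I) s alpha :
  continuous (fun u : {ptws J -> R} => potential s alpha u).
Proof.
apply: continuous_scale_sub; last exact: continuous_dot.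
move=> u; exact: (cvg_comp _ _ (@continuous_partition u)
  (continuous_ln (partition_function_gt0 i0 u))).
Qed.

Lemma compact_box (a b : R) :
  compact [set u : {ptws J -> R} | forall x, a <= u x <= b].
Proof.
have := @tychonoff J (fun=> R) (fun=> `[a, b]) (fun=> @segment_compact R a b).
congr compact; apply/seteqP; split => u /= ub x; have := ub x;
  by rewrite in_itv.
Qed.

(** The function of u that the hypothesis makes positive is continuous and
    positively homogeneous, so its minimum c over the unit sphere of the l1 norm
    bounds it below by c times the norm. *)
Lemma strictly_supported_growth (x0 : J) s alpha : strictly_supported s alpha ->
  exists2 c, 0 < c &
    forall u, exists i, c * l1norm u <= alpha * dot u (f i) - dot u s.
Proof.
move=> supp.
have [i0 _] : exists i : I, True.
  have [|i _] := supp (fun=> 1); last by exists i.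
  by exists x0; rewrite oner_neq0.
(* The default value 0 of the maximum is harmless, as only the points where some
   term is positive matter. *)
pose gap (u : {ptws J -> R}) := \big[Num.max/0]_i (alpha * dot u (f i) - dot u s).
have gap_cont : continuous gap.
  apply: (continuous_big (op := Num.max)) => [|i _]; first exact: max_continuous.
  by apply: continuous_scale_sub; exact: continuous_dot.
pose S := [set u : {ptws J -> R} | l1norm u = 1].
have S0 : S !=set0.
  exists (fun x => (x == x0)%:R); rewrite /S /= /l1norm (bigD1 x0) //= eqxx normr1.
  by rewrite big1 ?addr0 // => y /negPf ->; rewrite normr0.
have cS : compact S.
  refine (@subclosed_compact _ S _ _ (@compact_box (-1) 1) _).
    have -> : S = (fun u : {ptws J -> R} => l1norm u) @^-1` [set 1] by [].
    apply: preimage_closed => [u _|]; first exact: continuous_l1norm.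
    exact: closed_eq.
  by move=> u /= S1 x; rewrite -ler_norml -S1 le_l1norm.
have [|c /set_mem Sc cmin] := compact_EVT_min S0 cS (f := gap).
  exact: continuous_subspaceT.
have c0 : 0 < gap c.
  have [|i ai] := supp c.
    apply/existsP; rewrite -negb_forall; apply/forallP => c0.
    move: Sc; rewrite /S /= /l1norm big1 => [/esym/eqP|x _].
      by rewrite oner_eq0.
    by rewrite (eqP (c0 x)) normr0.
  rewrite ltNge; apply/negP => /bigmax_leP [_ /(_ i isT)].
  by rewrite subr_le0 leNgt ai.
exists (gap c) => // u.
have [u0|u0] := eqVneq (l1norm u) 0.
  exists i0; rewrite u0 mulr0.
  have uz x : u x = 0 by apply/eqP; rewrite -normr_le0 -u0 le_l1norm.
  by rewrite /dot !big1 ?mulr0 ?subrr // => x _; rewrite uz mul0r.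
have N0 : 0 < l1norm u by rewrite lt_def u0 sumr_ge0.
pose w x := (l1norm u)^-1 * u x.
have Sw : S w.
  rewrite /S /= /l1norm; under eq_bigr do rewrite normrM gtr0_norm ?invr_gt0 //.
  by rewrite -mulr_sumr mulVf.
have /bigmax_ltP : ~~ (gap w < gap c) by rewrite -leNgt cmin // inE.
move=> H; have [i Hi] : exists i, gap c <= alpha * dot w (f i) - dot w s.
  apply: contrapT => nH; apply: H; split => // i _.
  by rewrite ltNge; apply/negP => ?; apply: nH; exists i.
exists i; rewrite -ler_pdivlMr //; apply: le_trans Hi _.
by rewrite !dotZl mulrCA -mulrBr mulrC.
Qed.

Lemma growth_potential s alpha c u i : 0 <= alpha ->
  c * l1norm u <= alpha * dot u (f i) - dot u s ->
  c * l1norm u <= potential s alpha u.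
Proof.
move=> a0 /le_trans; apply.
by rewrite lerB // ler_wpM2l // ler_dot_ln_partition.
Qed.

(** Beyond the radius h 0 / c, the growth bound makes the potential h larger than
    h 0, so a minimum over a box of that radius is global. *)
Lemma strictly_supported_argmin (x0 : J) s alpha :
  0 < alpha -> strictly_supported s alpha ->
  exists u, forall v, potential s alpha u <= potential s alpha v.
Proof.
move=> a0 supp; have [c c0 grow] := strictly_supported_growth x0 supp.
have {grow} grow v : c * l1norm v <= potential s alpha v.
  by have [i] := grow v; apply: growth_potential; exact: ltW.
have [i0 _] : exists i : I, True.
  have [|i _] := supp (fun=> 1); last by exists i.
  by exists x0; rewrite oner_neq0.
pose z : J -> R := fun=> 0.
pose r := potential s alpha z / c.
pose B := [set u : {ptws J -> R} | forall x, - r <= u x <= r].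
have r0 : 0 <= r.
  rewrite divr_ge0 ?(ltW c0) //; apply: le_trans (grow z).
  by rewrite mulr_ge0 ?(ltW c0) // sumr_ge0.
have Bz : B z by move=> x; rewrite oppr_le0 r0.
have [| |u /set_mem Bu umin] := compact_EVT_min
  (f := potential s alpha : {ptws J -> R} -> R) _ (@compact_box (- r) r).
- by exists z.
- by apply: continuous_subspaceT; exact: continuous_potential.
exists u => v; have [Bv|nBv] := pselect (B v); first by apply: umin; rewrite inE.
apply: (@le_trans _ _ (potential s alpha z)); first by apply: umin; rewrite inE.
have [x rx] : exists x, r < `|v x|.
  apply: contrapT => nx; apply: nBv => x; rewrite -ler_norml leNgt.
  by apply/negP => ?; apply: nx; exists x.
apply: le_trans (grow v); rewrite -ler_pdivrMl // mulrC.
exact/ltW/(lt_le_trans rx)/le_l1norm.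
Qed.

Lemma is_derive_potential (i0 : I) s alpha u v (t : R) :
  is_derive t 1 (fun t : R => potential s alpha (fun y => u y + t * v y))
    (alpha * (\sum_i dot v (f i) * prob (fun y => u y + t * v y) i) - dot v s).
Proof.
have dlin w : is_derive t 1 (fun t : R => dot (fun y => u y + t * v y) w) (dot v w).
  rewrite (_ : (fun _ => _) = cst (dot u w) + dot v w \*: (@id R)); last first.
    by apply/funext => t' /=; rewrite dot_line mulrC.
  by apply: is_derive_eq; rewrite add0r /GRing.scale /= mulr1.
have dpart : is_derive t 1 (fun t : R => partition_function (fun y => u y + t * v y))
    (\sum_i dot v (f i) * expR (dot (fun y => u y + t * v y) (f i))).
  apply: is_derive_sum_seq => i; rewrite mulrC.
  exact: (@is_derive1_comp _ expR (fun t => dot (fun y => u y + t * v y) (f i))).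
have dln : is_derive t 1
    (fun t : R => ln (partition_function (fun y => u y + t * v y)))
    (\sum_i dot v (f i) * prob (fun y => u y + t * v y) i).
  under eq_bigr do rewrite /prob mulrA.
  rewrite -mulr_suml mulrC.
  apply: (@is_derive1_comp _ (@ln R)
    (fun t => partition_function (fun y => u y + t * v y))).
  exact/is_derive1_ln/partition_function_gt0.
exact: is_deriveB.
Qed.

(** The derivative of the potential along the coordinate x is
    alpha * mean u x - s x, which vanishes at a minimizer. *)
Lemma argmin_potential_mean (i0 : I) s alpha u :
  (forall v, potential s alpha u <= potential s alpha v) ->
  forall x, s x = alpha * mean u x.
Proof.
move=> umin x.
pose e : J -> R := fun y => (y == x)%:R.
pose phi t := potential s alpha (fun y => u y + t * e y).
have line0 : (fun y => u y + 0 * e y) = u by apply/funext => y; rewrite mul0r addr0.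
have dphi t := is_derive_potential i0 s alpha u e t.
have d0 : is_derive (0 : R) 1 phi 0.
  apply: (@derive1_at_min _ phi (-1) 1 0).
  - by lra.
  - by move=> t _; have := dphi t; case.
  - by rewrite in_itv /=; lra.
  - by move=> t _; rewrite /phi line0.
have := @derive_val _ _ _ _ _ _ _ (dphi 0).
rewrite (@derive_val _ _ _ _ _ _ _ d0) line0 dot_delta => /esym/eqP.
rewrite subr_eq0 => /eqP <-; congr (_ * _).
by apply: eq_bigr => i _; rewrite dot_delta.
Qed.

(** If no i beats the value m of the linear form v at the mean, then
    m - dot v (f i) is nonnegative for all i and averages to 0 with positive
    weights, so v is constant on the f i. *)
Lemma mean_strictly_supported (i0 : I) s alpha u :
  0 < alpha -> (forall x, f i0 x = 0) ->
  (forall v, (forall i, dot v (f i) = 0) -> forall x, v x = 0) ->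
  (forall x, s x = alpha * mean u x) ->
  strictly_supported s alpha.
Proof.
move=> a0 fi0 ident smean v [x vx].
apply: contrapT => nsupp.
pose p := prob u.
have p0 i : 0 < p i by rewrite divr_gt0 ?expR_gt0 ?(partition_function_gt0 i0).
have p1 : \sum_i p i = 1.
  by rewrite -mulr_suml mulfV // gt_eqF // (partition_function_gt0 i0).
have dvs : dot v s = alpha * \sum_i p i * dot v (f i).
  rewrite /dot; under eq_bigr do rewrite smean /mean mulrCA.
  rewrite -mulr_sumr; congr (_ * _).
  under eq_bigr do rewrite mulr_sumr.
  rewrite exchange_big; apply: eq_bigr => i _; rewrite mulr_sumr.
  by apply: eq_bigr => y _; rewrite [RHS]mulrCA; congr (_ * _); exact: mulrC.
pose m := \sum_i p i * dot v (f i).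
have le_m i : dot v (f i) <= m.
  rewrite -(ler_pM2l a0) -dvs leNgt; apply/negP => ?; apply: nsupp; by exists i.
have eq_m i : dot v (f i) = m.
  apply/eqP; rewrite -subr_eq0 -oppr_eq0 opprB.
  have : p i * (m - dot v (f i)) == 0.
    apply/eqP; apply: (psumr_eq0P (P := xpredT)
      (F := fun i => p i * (m - dot v (f i)))) => //.
      by move=> j _; rewrite mulr_ge0 ?(ltW (p0 j)) // subr_ge0.
    under eq_bigr do rewrite mulrBr.
    by rewrite sumrB -mulr_suml p1 mul1r subrr.
  by rewrite mulf_eq0 gt_eqF.
have m0 : m = 0 by rewrite -(eq_m i0) /dot big1 // => y _; rewrite fi0 mulr0.
by move/eqP: vx; apply; apply: ident => i; rewrite eq_m.
Qed.

(** ** Integrability of the density *)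

Definition coords (t : #|J|.-tuple (measurableTypeR R)) : J -> R :=
  fun x => tnth t (enum_rank x).

Definition proper_density s alpha : Prop :=
  (\int[lebesgue_tuple #|J|]_t (expR (- potential s alpha (coords t)))%:E < +oo)%E.

Lemma measurable_dot_coords w :
  measurable_fun setT (fun t : #|J|.-tuple (measurableTypeR R) => dot (coords t) w).
Proof.
apply: measurable_sum => x; apply: measurable_funM => //.
exact: measurable_tnth.
Qed.

Lemma measurable_density s alpha : measurable_fun setT
  (fun t : #|J|.-tuple (measurableTypeR R) => expR (- potential s alpha (coords t))).
Proof.
apply: measurableT_comp; first exact: measurable_expR.
apply: measurable_funN; apply: measurable_funB; last exact: measurable_dot_coords.
apply: measurable_funM => //; apply: measurableT_comp; first exact: measurable_ln.
apply: measurable_sum => i; apply: measurableT_comp; first exact: measurable_expR.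
exact: measurable_dot_coords.
Qed.

Lemma growth_proper s alpha c : 0 < c ->
  (forall u, c * l1norm u <= potential s alpha u) -> proper_density s alpha.
Proof.
move=> c0 grow; pose g (x : measurableTypeR R) : R := expR (- (c * `|x|)).
have mg : measurable_fun setT g.
  apply: measurableT_comp; first exact: measurable_expR.
  by apply: measurable_funN; apply: measurable_funM => //; exact: measurable_normr.
have g0 x : 0 <= g x by exact: expR_ge0.
have := integral_expR_opp_abs c0.
rewrite -/(g _) => goo.
have gfin : (\int[lebesgue_measure]_x (g x)%:E \is a fin_num)%E.
  by rewrite ge0_fin_numE // integral_ge0 // => x _; rewrite lee_fin.
rewrite /proper_density; apply: (@le_lt_trans _ _
    (\int[lebesgue_tuple #|J|]_t (\prod_(i < #|J|) g (tnth t i))%:E)%E).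
  apply: ge0_le_integral => //.
  - by apply/measurable_EFinP; exact: measurable_density.
  - apply/measurable_EFinP; apply: measurable_prod => i _.
    by apply: measurableT_comp; [exact: mg|exact: measurable_tnth].
  move=> t _; rewrite lee_fin -expR_sum ler_expR sumrN lerN2.
  apply: le_trans (grow _); rewrite /l1norm mulr_sumr.
  rewrite [leRHS](reindex _ (onW_bij _ (@enum_val_bij J))) /=.
  by under [leRHS]eq_bigr do rewrite /coords enum_valK.
rewrite (@integral_lebesgue_tuple_prod _ _ (fun=> g)) //.
by rewrite -(fineK gfin) prodEFin ltry.
Qed.

(** A recession direction u of the potential, with K its bound along u, rules out
    integrability. *)
Lemma bounded_on_translates_not_proper s alpha (u : J -> R) (x0 : J) (K : R) :
  1 <= `|u x0| ->
  (forall (m : nat) b, (forall x, 0 <= b x <= 1) ->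
     potential s alpha (fun x => b x + m%:R * u x) <= K) ->
  ~ proper_density s alpha.
Proof.
move=> u1 uK; rewrite /proper_density.
suff -> : (\int[lebesgue_tuple #|J|]_t
    (expR (- potential s alpha (coords t)))%:E = +oo)%E.
  by rewrite ltxx.
apply: (@integral_eq_pinfty_unit_boxes R #|J| (fun i => u (enum_val i))
  (enum_rank x0) _ (expR (- K))).
- by rewrite enum_rankK.
- exact: measurable_density.
- by move=> t; exact: expR_ge0.
- exact: expR_gt0.
move=> m t tm; rewrite ler_expR lerN2.
have := uK m (fun x => coords t x - m%:R * u x).
under [X in potential _ _ X]eq_fun do rewrite subrK.
apply => x; have := tm (enum_rank x); rewrite enum_rankK /coords => /andP[? ?].
by apply/andP; split; lra.
Qed.

Lemma dot_box_ge b s : (forall x, 0 <= b x <= 1) -> - l1norm s <= dot b s.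
Proof.
move=> b01; rewrite lerNl -sumrN; apply: ler_sum => x _; have /andP[b0 b1] := b01 x.
apply: le_trans (ler_norm _) _; rewrite normrN normrM (ger0_norm b0).
by rewrite ler_piMl.
Qed.

(** As Z u >= 1, for alpha <= 0 the potential is at most - <u, s>, which does not
    increase along the direction e of the axis x0 that has <e, s> >= 0. *)
Lemma proper_alpha_gt0 (i0 : I) (x0 : J) s alpha :
  (forall x, f i0 x = 0) -> proper_density s alpha -> 0 < alpha.
Proof.
move=> fi0 sp; rewrite ltNge; apply/negP => a0; move: sp.
pose e : R := if 0 <= s x0 then 1 else -1.
apply: (@bounded_on_translates_not_proper _ _ (fun x => e * (x == x0)%:R) x0
  (l1norm s)).
  by rewrite eqxx mulr1 /e; case: ifP => _; rewrite ?normrN normr1.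
move=> m b b01; rewrite /potential.
have -> : dot (fun x => b x + m%:R * (e * (x == x0)%:R)) s = dot b s + m%:R * `|s x0|.
  rewrite dot_line dotZl dot_delta; congr (_ + _ * _); rewrite /e.
  by case: (ger0P (s x0)) => ?; rewrite ?mul1r ?mulN1r.
set w := (fun x => _).
have Z1 : 0 <= ln (partition_function w).
  apply: le_trans (ler_dot_ln_partition w i0).
  by rewrite /dot big1 // => x _; rewrite fi0 mulr0.
have := dot_box_ge s b01; have : 0 <= m%:R * `|s x0| by rewrite mulr_ge0.
have : alpha * ln (partition_function w) <= 0 by rewrite mulr_le0_ge0.
by lra.
Qed.

(** Moving by m * u multiplies each term of Z by exp (m * <u, f i>), hence by at
    most exp (m * <u, s> / alpha), which the linear term of the potential
    compensates. *)
Lemma potential_translate_le (i0 : I) s alpha u v (m : R) : 0 < alpha -> 0 <= m ->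
  (forall i, alpha * dot u (f i) <= dot u s) ->
  potential s alpha (fun x => v x + m * u x) <= potential s alpha v.
Proof.
move=> a0 m0 us; rewrite /potential dot_line.
have Zle : partition_function (fun x => v x + m * u x) <=
    partition_function v * expR (m * (dot u s / alpha)).
  rewrite /partition_function mulr_suml; apply: ler_sum => i _.
  rewrite -expRD ler_expR dot_line lerD2l ler_wpM2l //.
  by rewrite ler_pdivlMr // mulrC.
have : ln (partition_function (fun x => v x + m * u x)) <=
    ln (partition_function v) + m * (dot u s / alpha).
  rewrite -[X in _ + X]expRK -lnM ?posrE ?expR_gt0 ?partition_function_gt0 //.
  by rewrite ler_ln ?posrE ?mulr_gt0 ?expR_gt0 ?partition_function_gt0.
rewrite -(ler_pM2l a0) mulrDr => /le_trans.
have -> : alpha * (m * (dot u s / alpha)) = m * dot u s.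
  by rewrite mulrCA; congr (_ * _); rewrite mulrCA mulfV ?mulr1 // gt_eqF.
by move=> /(_ _ (lexx _)); lra.
Qed.

Lemma proper_strictly_supported (i0 : I) s alpha :
  0 < alpha -> proper_density s alpha -> strictly_supported s alpha.
Proof.
move=> a0 + u [x0 ux0]; apply: contraPP => nsupp.
have us i : alpha * dot u (f i) <= dot u s.
  by rewrite leNgt; apply/negP => ?; apply: nsupp; exists i.
pose B := [set b : {ptws J -> R} | forall x, 0 <= b x <= 1].
have [| |b _ bmax] := compact_EVT_max
  (f := potential s alpha : {ptws J -> R} -> R) (A := B) _ (@compact_box 0 1).
- by exists (fun=> 0) => x; rewrite lexx ler01.
- by apply: continuous_subspaceT; exact: continuous_potential.
apply: (@bounded_on_translates_not_proper _ _ (fun x => `|u x0|^-1 * u x) x0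
  (potential s alpha b)).
  by rewrite normrM normfV normr_id mulVf ?normr_eq0.
move=> m v v01; apply: (@le_trans _ _ (potential s alpha v)); last first.
  by apply: bmax; rewrite inE.
apply: potential_translate_le => // i.
by rewrite !dotZl mulrCA ler_wpM2l // invr_ge0.
Qed.

(** The integrability criterion of Diaconis and Ylvisaker for conjugate priors. *)
Theorem proper_iff_mean (i0 : I) (x0 : J) s alpha : (forall x, f i0 x = 0) ->
  (forall v, (forall i, dot v (f i) = 0) -> forall x, v x = 0) ->
  proper_density s alpha <->
  0 < alpha /\ exists u, forall x, s x / alpha = mean u x.
Proof.
move=> fi0 ident; split=> [sp|[a0 [u umean]]].
  have a0 := proper_alpha_gt0 x0 fi0 sp; split=> //.
  have supp := proper_strictly_supported i0 a0 sp.
  have [u umin] := strictly_supported_argmin x0 a0 supp.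
  exists u => x; rewrite (argmin_potential_mean i0 umin x).
  by rewrite mulrAC mulfV ?mul1r // gt_eqF.
have supp : strictly_supported s alpha.
  apply: (@mean_strictly_supported i0 s alpha u) => // x.
  by rewrite -umean mulrCA mulfV ?mulr1 // gt_eqF.
have [c c0 grow] := strictly_supported_growth x0 supp.
apply: (growth_proper c0) => v; have [i] := grow v.
exact/growth_potential/ltW.
Qed.

End ExponentialFamily.

(** * The log-linear model as an exponential family *)

Section LogLinear.
Variables (V : finType) (I_ : V -> finType) (lvl0 : forall g : V, I_ g).
Variables (DD : {set {set V}}) (R : realType).
Local Notation J := (param_index lvl0 DD).

Definition suff_stat (i : cell I_) (x : J) : R :=
  (restr (tag (val x)) i == tagged (val x))%:R.

Definition extend (D : {set V}) (m : margin I_ D) : cell I_ :=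
  [ffun g =>
    if pselect (g \in D) is left gD then m (exist _ g gD) else lvl0 g].

Lemma restr_extend (D : {set V}) (m : margin I_ D) : restr D (extend m) = m.
Proof.
apply/ffunP => -[g gD]; rewrite !ffunE /=.
by case: pselect => // gD'; rewrite (eq_irrelevance gD' gD).
Qed.

Lemma extend_out (D : {set V}) (m : margin I_ D) g :
  g \notin D -> extend m g = lvl0 g.
Proof.
by move=> gD; rewrite ffunE; case: pselect => // gD'; rewrite gD' in gD.
Qed.

Lemma param_tag_in (x : J) : tag (val x) \in DD.
Proof. by case: x => -[D m] /= /andP[]. Qed.

(** This confines the index sets D of the elements of J matched by a cell to the
    set of criteria where the cell has a nonzero level. *)
Lemma match_neq_lvl0 (i : cell I_) (x : J) g :
  restr (tag (val x)) i == tagged (val x) -> g \in tag (val x) -> i g != lvl0 g.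
Proof.
case: x => -[D m] /= /andP[_ /=]; rewrite inE => /forallP ms /eqP im gD.
by have := ms (Sub g gD); rewrite -im ffunE.
Qed.

(** The sets D in D_i^* are in bijection with the elements of J that match the
    cell i. *)
Lemma cell_logitE (theta : {ffun J -> R}) (i : cell I_) :
  cell_logit theta i = dot theta (suff_stat i).
Proof.
rewrite /dot /suff_stat; under [RHS]eq_bigr do rewrite mulr_natr mulrb.
rewrite -big_mkcond /cell_logit.
rewrite (reindex_omap (restr_param (i := i)) (fun x : J => insub (tag (val x)))) /=.
  by apply: eq_bigl => D; rewrite eqxx /= valK eqxx.
move=> x xi; case: insubP => [D _ /= Dx|].
  congr Some; apply: val_inj => /=.
  case: x xi Dx => -[E m] p /= /eqP <- DE.
  by rewrite DE.
rewrite inE param_tag_in /= => /negP[].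
by apply/forall_inP => g; exact: match_neq_lvl0.
Qed.

Lemma suff_stat_cell0 (x : J) :
  finset.set0 \notin DD -> suff_stat (cell0 lvl0) x = 0.
Proof.
move=> D0; rewrite /suff_stat; case: eqP => // /eqP xi.
have /set0Pn[g gx] : tag (val x) != finset.set0.
  by apply: contraNneq D0 => <-; exact: param_tag_in.
by have := match_neq_lvl0 xi gx; rewrite ffunE eqxx.
Qed.

Lemma normalizerE (theta : {ffun J -> R}) : finset.set0 \notin DD ->
  normalizer theta = partition_function suff_stat theta.
Proof.
move=> D0; rewrite /partition_function (bigD1 (cell0 lvl0)) //= /normalizer.
congr (_ + _).
  by rewrite /dot big1 ?expR0 // => x _; rewrite suff_stat_cell0 ?mulr0.
by apply: eq_bigr => i _; rewrite cell_logitE.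
Qed.

(** By induction on the size of D, the coordinate of v at x = (D, m) vanishes: the
    cell i that extends m by zero levels matches, besides x, only elements (E, n)
    with E a proper subset of D, where v is already known to vanish. *)
Lemma suff_stat_identifiable (v : J -> R) :
  (forall i, dot v (suff_stat i) = 0) -> forall x, v x = 0.
Proof.
move=> v0 x; have [n] := ubnP #|tag (val x)|.
elim: n x => // n IHn x; rewrite ltnS => xn.
pose i := extend (tagged (val x)).
have := v0 i; rewrite /dot (bigD1 x) //= big1 ?addr0.
  by rewrite /suff_stat restr_extend eqxx mulr1.
move=> y yx; rewrite /suff_stat; case: eqP => [/eqP yi|]; last by rewrite mulr0.
have sub_yx : tag (val y) \subset tag (val x).
  apply/fintype.subsetP => g gy; apply: contraTT (match_neq_lvl0 yi gy) => gx.
  by rewrite negbK; apply/eqP/extend_out.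
rewrite IHn ?mul0r //; apply: leq_trans xn; apply: proper_card.
rewrite finset.properEneq sub_yx andbT; apply: contraNneq yx => tag_yx.
apply/eqP/val_inj; move: yi; rewrite /i.
case: (val x) (val y) tag_yx => [D m] [E m'] /= DE.
by move: m'; rewrite DE restr_extend => m' /eqP ->.
Qed.

Lemma proper_priorE (s : {ffun J -> R}) alpha : finset.set0 \notin DD ->
  proper_prior s alpha <-> proper_density suff_stat s alpha.
Proof.
move=> D0; rewrite /proper_prior /proper_density.
suff kE t : prior_kernel s alpha (Finfun t) =
    expR (- potential suff_stat s alpha (coords t)) by under eq_integral do rewrite kE.
rewrite /prior_kernel normalizerE // /potential opprB.
have -> // : coords t = Finfun t.
apply/funext => x.
by rewrite /coords -[in LHS](FinfunK t) tnth_fgraph enum_rankK.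
Qed.

Lemma margin_probE (theta : {ffun J -> R}) (x : J) : finset.set0 \notin DD ->
  \sum_(j : cell I_ | restr (tag (val x)) j == tagged (val x))
    cell_prob theta j = mean suff_stat theta x.
Proof.
move=> D0; rewrite big_mkcond; apply: eq_bigr => j _.
rewrite /cell_prob normalizerE // cell_logitE /prob /suff_stat.
by case: ifP => _; rewrite ?mul1r ?mul0r.
Qed.

End LogLinear.

Theorem lemma3p1 (V : finType) (I_ : V -> finType) (lvl0 : forall g : V, I_ g)
    (DD : {set {set V}}) (hDD : hierarchical DD)
    (hJ : (0 < #|param_index lvl0 DD|)%N) (R : realType)
    (s : {ffun param_index lvl0 DD -> R}) (alpha : R) :
  proper_prior s alpha <-> Pi_G (s, alpha).
Proof.
have [D0 _] := hDD; have /card_gt0P[x0 _] := hJ.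
rewrite proper_priorE // (@proper_iff_mean _ _ _ _ (cell0 lvl0) x0); first last.
- exact: suff_stat_identifiable.
- by move=> x; exact: suff_stat_cell0.
rewrite /Pi_G /=; split=> -[a0 [u umean]]; split=> //.
  exists (finfun u) => x; rewrite margin_probE // umean.
  by rewrite (_ : (finfun u : _ -> _) = u) //; apply/funext => y; rewrite ffunE.
by exists u => x; rewrite umean margin_probE.
Qed.
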